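(* Let $A:\mathbb{R}^n\to\mathbb{R}^{n\times n}$ be symmetric-matrix valued, three times continuously differentiable at every $v\neq 0$, with $A(\alpha v)=A(v)$ for all $\alpha\in\mathbb{R}\setminus\{0\}$. Let $J(v):=\frac{\partial}{\partial v}(A(v)v)$, and for $\sigma\in\mathbb{R}$ define $\varphi(v):=\psi(v)/\|\psi(v)\|_2$ with $\psi(v):=(J(v)-\sigma I)^{-1}v$ (whenever $J(v)-\sigma I$ is nonsingular). Suppose $(\lambda_*,v_* )$ satisfies $A(v_* )v_*=\lambda_*v_*$ with $\|v_*\|_2=1$, and let $\sigma\in\mathbb{R}$ be such that $J(v_* )-\sigma I$ is nonsingular. Then $$\varphi'(v_* )=|\lambda_*-\sigma|\,(I-v_*v_*^T)\,(J(v_* )-\sigma I)^{-1}.$$ Moreover, if the iterates $v_{k+1}=\varphi(v_k)$ (i.e., $v_{k+1}=(J(v_k)-\sigma I)^{-1}v_k/\|(J(v_k)-\sigma I)^{-1}v_k\|_2$) are such that $J(v_k)-\sigma I$ is nonsingular for all $k$, then $$v_{k+1}\mp v_*=\varphi'(v_* )(v_k-v_* )+O(\|v_k-v_*\|^2),$$ where the sign is ''$-$'' (i.e., $v_{k+1}-v_*$) if $\sigma<\lambda_*$ and ''$+$'' (i.e., $v_{k+1}+v_*$) if $\sigma>\lambda_*$.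
   Context: $\varphi'(v)$ denotes the Jacobian matrix of $\varphi$ at $v$; $\|\cdot\|_2$ is the Euclidean norm; the $O$-term refers to $v_k\to v_*$. *)

(* Defs.v *)
From HB Require Import structures.
From mathcomp Require Import all_boot all_order all_algebra.
From mathcomp Require Import all_classical all_reals all_analysis.
Set Implicit Arguments. Unset Strict Implicit. Unset Printing Implicit Defensive.
Import Order.TTheory GRing.Theory Num.Theory.
Import numFieldNormedType.Exports.
Local Open Scope classical_set_scope.
Local Open Scope ring_scope.

(* Conventions: a vector of R^n is represented by a row vector v : 'rV[R]_n
   (the column vector of the paper is v^T).  The product "M v" of the paper
   (matrix times column vector) is thus  mv M v := v *m M^T  = (M *m v^T)^T. *)
Definition mv (R : ringType) n (M : 'M[R]_n) (v : 'rV[R]_n) : 'rV[R]_n :=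
  v *m M^T.

Definition norm2 (R : realType) n (v : 'rV[R]_n) : R :=
  Num.sqrt (\sum_(i < n) v ord0 i ^+ 2).

(* The Jacobian matrix (d f_i / d x_j)_{i,j} of f at p.  The library's
   [jacobian] satisfies 'D_h f p = h *m jacobian f p for row vectors, i.e.
   it is the transpose of the usual Jacobian matrix. *)
Definition Jac (R : realType) n (f : 'rV[R]_n -> 'rV[R]_n) (p : 'rV[R]_n)
  : 'M[R]_n := (jacobian f p)^T.

Fixpoint iter_derive (R : realType) (V W : normedModType R)
  (us : seq V) (f : V -> W) : V -> W :=
  match us with
  | [::] => f
  | u :: us' => fun x => 'D_u (iter_derive us' f) x
  end.

(* f is k times continuously differentiable on the (open) set U : all
   (iterated) directional derivatives of order <= k exist and are continuous
   on U (for finite-dimensional spaces this is the usual C^k notion). *)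
Definition Ck_on (R : realType) (V W : normedModType R) (k : nat)
  (U : set V) (f : V -> W) : Prop :=
  forall us : seq V, (size us <= k)%N ->
    (forall x, U x -> {for x, continuous (iter_derive us f)}) /\
    ((size us < k)%N -> forall u x, U x -> derivable (iter_derive us f) x u).

Section Newton.
Variables (R : realType) (n : nat) (A : 'rV[R]_n -> 'M[R]_n) (sigma : R).

Definition Fmap (v : 'rV[R]_n) : 'rV[R]_n := mv (A v) v.

Definition Jmap (v : 'rV[R]_n) : 'M[R]_n := Jac Fmap v.

Definition psi (v : 'rV[R]_n) : 'rV[R]_n :=
  mv (invmx (Jmap v - sigma%:M)) v.

Definition phi (v : 'rV[R]_n) : 'rV[R]_n := (norm2 (psi v))^-1 *: psi v.

End Newton.

(* Main.v *)
Require Import Defs.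
From HB Require Import structures.
From mathcomp Require Import all_boot all_order all_algebra.
From mathcomp Require Import all_classical all_reals all_analysis.
From mathcomp Require Import ring lra.
Import Order.TTheory GRing.Theory Num.Theory.
Import numFieldNormedType.Exports.
Local Open Scope classical_set_scope.
Local Open Scope ring_scope.
Set Implicit Arguments.
Unset Strict Implicit.
Unset Printing Implicit Defensive.

(** Write F(v) = A(v)v, G = J^T (the library's jacobian of F), B = G - sigma I,
    h = v - v_* and mu = lambda_* - sigma, all vectors being rows.  F is
    homogeneous of degree 1, so Euler's identity gives v G(v) = F(v) for every
    v <> 0; hence v_* B(v_* ) = mu v_* and
      v_* (G(v) - G(v_* )) = F(v) - F(v_* ) - h G(v_* ) - h (G(v) - G(v_* )).
    Since G is Lipschitz at v_*, the right-hand side is O(|h|^2): the derivative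
    of J contributes nothing to first order in psi, and
      psi(v) = v_* / mu + h B(v_* )^-1 + O(|h|^2).
    Expanding the normalisation x |-> x / |x| around v_* / mu yields a quadratic
    expansion of phi at v_*.  Such an expansion implies differentiability and
    identifies the derivative, so both claims of the theorem come from it. *)

(** The bound is required at [x] itself too, so for [k > 0] it forces [f x = 0]; this is how
    [quadratic_expansion] recovers the value at [x]. *)
Definition Opow (R : realType) (V W : normedModType R) (x : V) (k : nat)
    (f : V -> W) :=
  exists C : R, \forall v \near x, `|f v| <= C * `|v - x| ^+ k.

(** * Calculus of O(|v - x|^k) terms *)

Section Opow.
Variables (R : realType) (V : normedModType R) (x : V).
Implicit Type W : normedModType R.

Lemma OpowP W k (f : V -> W) : Opow x k f ->
  exists2 C : R, 0 < C & \forall v \near x, `|f v| <= C * `|v - x| ^+ k.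
Proof.
move=> [C fC]; exists (`|C| + 1); first by rewrite ltr_wpDl.
near=> v.
have vC : `|f v| <= C * `|v - x| ^+ k by near: v.
apply: le_trans vC _; rewrite ler_wpM2r ?exprn_ge0//.
by rewrite ler_wpDr ?ler01 ?ler_norm.
Unshelve. all: by end_near. Qed.

Lemma Opow_ball W k (f : V -> W) : Opow x k f ->
  exists C d : R, [/\ 0 < C, 0 < d &
    forall v, `|v - x| < d -> `|f v| <= C * `|v - x| ^+ k].
Proof.
move=> /OpowP[C C0 /nbhs_normP[d d0 fC]]; exists C, d; split=> // v vx.
by apply: fC; rewrite /= distrC.
Qed.

Lemma Opow_near W k (f g : V -> W) :
  (\forall v \near x, f v = g v) -> Opow x k f -> Opow x k g.
Proof.
move=> fg [C fC]; exists C; near=> v.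
have <- : f v = g v by near: v.
by near: v.
Unshelve. all: by end_near. Qed.

Lemma Opow_eq W k (f g : V -> W) :
  (forall v, f v = g v) -> Opow x k f -> Opow x k g.
Proof. by move=> fg; apply: Opow_near; apply: nearW. Qed.

Lemma OpowD W k (f g : V -> W) :
  Opow x k f -> Opow x k g -> Opow x k (fun v => f v + g v).
Proof.
move=> [C fC] [D gD]; exists (C + D); near=> v.
rewrite mulrDl (le_trans (ler_normD _ _))// lerD//; by near: v.
Unshelve. all: by end_near. Qed.

Lemma OpowN W k (f : V -> W) : Opow x k f -> Opow x k (fun v => - f v).
Proof.
by move=> [C fC]; exists C; apply: filterS fC => v; rewrite normrN.
Qed.

Lemma OpowB W k (f g : V -> W) :
  Opow x k f -> Opow x k g -> Opow x k (fun v => f v - g v).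
Proof. by move=> fO gO; apply: OpowD => //; exact: OpowN. Qed.

(** Common source of the rules for products, scalings and matrix products: each operation satisfies
    such a norm bound. *)
Lemma Opow_mul (W1 W2 W : normedModType R) (op : W1 -> W2 -> W) (M : R) j k
    (f : V -> W1) (g : V -> W2) :
  (forall a b, `|op a b| <= M * (`|a| * `|b|)) ->
  Opow x j f -> Opow x k g -> Opow x (j + k) (fun v => op (f v) (g v)).
Proof.
move=> opM /OpowP[C C0 fC] /OpowP[D D0 gD]; exists (`|M| * (C * D)); near=> v.
apply: le_trans (opM _ _) _; apply: (@le_trans _ _ (`|M| * (`|f v| * `|g v|))).
  by rewrite ler_wpM2r ?mulr_ge0// ler_norm.
rewrite exprD -mulrA ler_wpM2l// mulrACA ler_pM//; by near: v.
Unshelve. all: by end_near. Qed.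

Lemma OpowM j k (f g : V -> R) :
  Opow x j f -> Opow x k g -> Opow x (j + k) (fun v => f v * g v).
Proof. by apply: (@Opow_mul R R R *%R 1) => a b; rewrite mul1r normrM. Qed.

Lemma OpowZ W j k (f : V -> R) (g : V -> W) :
  Opow x j f -> Opow x k g -> Opow x (j + k) (fun v => f v *: g v).
Proof. by apply: (@Opow_mul R W W *:%R 1) => a b; rewrite mul1r normrZ. Qed.

Lemma Opow_cst W (a : W) : Opow x 0 (fun=> a).
Proof. by exists `|a|; apply: nearW => v; rewrite expr0 mulr1. Qed.

Lemma OpowcM k (c : R) (f : V -> R) : Opow x k f -> Opow x k (fun v => c * f v).
Proof. by move=> fO; exact: OpowM (Opow_cst c) fO. Qed.

Lemma OpowcZ W k (c : R) (f : V -> W) :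
  Opow x k f -> Opow x k (fun v => c *: f v).
Proof. by move=> fO; exact: OpowZ (Opow_cst c) fO. Qed.

Lemma OpowZc W k (f : V -> R) (a : W) :
  Opow x k f -> Opow x k (fun v => f v *: a).
Proof. by move=> fO; rewrite -[k]addn0; exact: OpowZ fO (Opow_cst a). Qed.

Lemma Opow0 W k : Opow x k (fun=> 0 : W).
Proof. by exists 0; apply: nearW => v; rewrite mul0r normr0. Qed.

Lemma Opow_sum W k (I : Type) (r : seq I) (f : I -> V -> W) :
  (forall i, Opow x k (f i)) -> Opow x k (fun v => \sum_(i <- r) f i v).
Proof.
move=> fO; elim: r => [|i r IHr].
  by apply: Opow_eq (Opow0 _ k) => v; rewrite big_nil.
by apply: Opow_eq (OpowD (fO i) IHr) => v; rewrite big_cons.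
Qed.

Lemma Opow_sub : Opow x 1 (fun v => v - x).
Proof. by exists 1; apply: nearW => v; rewrite mul1r. Qed.

Lemma Opow_le W j k (f : V -> W) : (j <= k)%N -> Opow x k f -> Opow x j f.
Proof.
move=> jk /OpowP[C C0 fC]; exists C; near=> v.
have /le_trans -> // : `|f v| <= C * `|v - x| ^+ k by near: v.
by rewrite ler_pM2l// ler_wiXn2l.
Unshelve. all: by end_near. Qed.

Lemma Opow_cvg0 W k (f : V -> W) (e : R) : Opow x k.+1 f -> 0 < e ->
  \forall v \near x, `|f v| <= e.
Proof.
move=> /(@Opow_le _ 1 k.+1 f isT)/OpowP[C C0 fC] e0; near=> v.
have /le_trans -> // : `|f v| <= C * `|v - x| ^+ 1 by near: v.
rewrite expr1 -ler_pdivlMl// mulrC.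
rewrite distrC; apply/ltW.
by near: v; apply/nbhs_normP; exists (e / C) => //=; exact: divr_gt0.
Unshelve. all: by end_near. Qed.

Lemma Opow_continuous W k (f : V -> W) :
  Opow x k.+1 (fun v => f v - f x) -> {for x, continuous f}.
Proof.
move=> fO; apply/cvgrPdist_le => e e0.
by apply: filterS (Opow_cvg0 fO e0) => v; rewrite distrC.
Qed.

Lemma Opow_cst_diff W k (f : V -> W) (a : W) :
  Opow x k (fun v => f v - a) -> Opow x 0 f.
Proof.
move=> /(Opow_le (leq0n k))/OpowD/(_ (Opow_cst a)).
by apply: Opow_eq => v; rewrite subrK.
Qed.

(** The differential is bounded by some [k], and the little-o remainder is eventually at most [|h|],
    whence the constant [k + 1]. *)
Lemma differentiable_Opow W (f : V -> W) :
  differentiable f x -> Opow x 1 (fun v => f v - f x).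
Proof.
move=> df; have /diff_locally := df.
have [k k0 dfk] := linear_lipschitz (diff_continuous df).
move=> /eqaddoP/(_ 1 ltr01) fo; exists (k + 1).
have : \forall h \near (0 : V), `|f (h + x) - f x| <= (k + 1) * `|h|.
  apply: filterS fo => h /=.
  rewrite mul1r => fh.
  have -> : f (h + x) - f x = 'd f x h + (f (h + x) - (f x + 'd f x h)).
    rewrite [in RHS]addrC -addrA; congr (_ + _).
    by rewrite opprD -addrA addNr addr0.
  rewrite (le_trans (ler_normD _ _))// mulrDl mul1r. exact: lerD (dfk h) fh.
rewrite (near_shift x) sub0r; apply: filterS => v /=.
by rewrite subrK expr1.
Qed.

End Opow.

(** Epsilon-delta criterion for a candidate differential [df]; it serves both for continuous
    partials and for quadratic expansions. *)
Lemma differentiable_eps (R : realType) (V W : normedModType R)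
    (f : V -> W) (df : {linear V -> W}) (x : V) :
  continuous df ->
  (forall e : R, 0 < e -> exists2 d : R, 0 < d & forall h, `|h| < d ->
     `|f (h + x) - f x - df h| <= e * `|h|) ->
  differentiable f x /\ 'd f x = df :> (V -> W).
Proof.
move=> cdf fdf.
have E : f \o shift x = cst (f x) + df +o_ (0 : V) id.
  apply/eqaddoP => e /fdf[d d0 dP].
  apply/nbhs_normP; exists d => // h; rewrite /ball_/= sub0r normrN => /dP.
  by rewrite -[(_ - _) h]/(f (h + x) - (f x + df h)) opprD addrA.
split; last exact: diff_unique.
by apply/diff_locallyP; rewrite (diff_unique cdf E).
Qed.

(** * O-terms for matrices under the maximum norm of the entries *)

Section matrix_Opow.
Variables (R : realType).

Lemma mx_entry_le m n (M : 'M[R]_(m, n)) i j : `|M i j| <= `|M|.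
Proof.
rewrite [leRHS]/Num.Def.normr/= mx_normrE.
exact: (le_bigmax _ (fun ij => `|M ij.1 ij.2|) (i, j)).
Qed.

Lemma mx_norm_le m n (M : 'M[R]_(m, n)) (e : R) :
  0 <= e -> (forall i j, `|M i j| <= e) -> `|M| <= e.
Proof.
move=> e0 Me; rewrite [leLHS]/Num.Def.normr/= mx_normrE.
by apply: bigmax_le => // -[i j] _; exact: Me.
Qed.

(** The factor [n] counts the summands of an entry: the maximum norm is not submultiplicative. *)
Lemma mulmx_norm_le m n p (M : 'M[R]_(m, n)) (N : 'M[R]_(n, p)) :
  `|M *m N| <= n%:R * (`|M| * `|N|).
Proof.
apply: mx_norm_le => [|i j]; first by rewrite !mulr_ge0.
rewrite mxE (le_trans (ler_norm_sum _ _ _))//.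
rewrite -[n in n%:R]card_ord -sumr_const mulr_suml; apply: ler_sum => k _.
by rewrite mul1r normrM ler_pM// mx_entry_le.
Qed.

Lemma trmx_norm_le m n (M : 'M[R]_(m, n)) : `|M^T| <= `|M|.
Proof. by apply: mx_norm_le => // i j; rewrite mxE mx_entry_le. Qed.

Variables (V : normedModType R) (x : V).

Lemma Opow_mulmx m n p j k (f : V -> 'M[R]_(m, n)) (g : V -> 'M[R]_(n, p)) :
  Opow x j f -> Opow x k g -> Opow x (j + k) (fun v => f v *m g v).
Proof. by apply: Opow_mul => a b; exact: mulmx_norm_le. Qed.

Lemma Opow_tr m n k (f : V -> 'M[R]_(m, n)) :
  Opow x k f -> Opow x k (fun v => (f v)^T).
Proof.
move=> [C fC]; exists C; apply: filterS fC => v; apply: le_trans.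
exact: trmx_norm_le.
Qed.

Lemma Opow_entry m n k (f : V -> 'M[R]_(m, n)) i j :
  Opow x k f -> Opow x k (fun v => f v i j).
Proof.
move=> [C fC]; exists C; apply: filterS fC => v; apply: le_trans.
exact: mx_entry_le.
Qed.

Lemma Opow_mx m n k (f : V -> 'M[R]_(m, n)) :
  (forall i j, Opow x k (fun v => f v i j)) -> Opow x k f.
Proof.
move=> fO; apply: (@Opow_eq _ _ _ _ _
    (fun v => \sum_i \sum_j f v i j *: delta_mx i j)) => [v|].
  by rewrite -matrix_sum_delta.
do 2!apply: Opow_sum => ?.
exact: OpowZc.
Qed.

End matrix_Opow.

(** * Continuous partial derivatives imply differentiability *)

Section mean_value.
Variables (R : realType) (V : normedModType R).

(** Both derivatives are limits of the same difference quotient, once the line is reparametrised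
    from [s]. *)
Lemma is_derive_line (g : V -> R) (y u : V) (s : R) :
  derivable g (s *: u + y) u ->
  is_derive s 1 (fun t => g (t *: u + y)) ('D_u g (s *: u + y)).
Proof.
have E : (fun h : R => h^-1 *: (g ((h *: (1 : R^o) + s) *: u + y) - g (s *: u + y)))
       = (fun h : R => h^-1 *: (g (h *: u + (s *: u + y)) - g (s *: u + y))).
  apply/funext => h; congr (_ *: (g _ - _)).
  by rewrite [h *: _]mulr1 scalerDl addrA.
by move=> dg; apply: DeriveDef; rewrite /derivable /derive E.
Qed.

Lemma MVT_line (g : V -> R) (y u : V) (a b : R) : a <= b ->
  (forall s, a <= s <= b -> derivable g (s *: u + y) u) ->
  exists2 c, a <= c <= b &
    g (b *: u + y) - g (a *: u + y) = 'D_u g (c *: u + y) * (b - a).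
Proof.
move=> ab dg.
have [||c cab E] := @MVT_segment R (fun t => g (t *: u + y))
  (fun s => 'D_u g (s *: u + y)) a b ab.
- move=> s; rewrite in_itv/= => /andP[/ltW as_ /ltW sb].
  by apply: is_derive_line; apply: dg; rewrite as_ sb.
- apply: derivable_within_continuous => s; rewrite in_itv/= => sab.
  by have [] := is_derive_line (dg _ sab).
- by exists c => //; move: cab; rewrite in_itv.
Qed.

(** Version for an increment [t] of either sign, as the coordinates of a displacement have arbitrary
    signs. *)
Lemma MVT_increment (g : V -> R) (y u : V) (t : R) :
  (forall s, `|s| <= `|t| -> derivable g (s *: u + y) u) ->
  exists2 c, `|c| <= `|t| & g (t *: u + y) - g y = 'D_u g (c *: u + y) * t.
Proof.
move=> dg; have [t0|t0] := leP 0 t.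
  have [|c /andP[c0 ct] E] := @MVT_line g y u 0 t t0.
    by move=> s /andP[s0 st]; apply: dg; rewrite !ger0_norm.
  by exists c; [rewrite !ger0_norm|move: E; rewrite scale0r add0r subr0].
have [|c /andP[ct c0] E] := @MVT_line g y u t 0 (ltW t0).
  by move=> s /andP[st s0]; apply: dg; rewrite !ler0_norm ?lerN2// ltW.
exists c; first by rewrite !ler0_norm ?lerN2// ltW.
by move: E; rewrite scale0r add0r sub0r mulrN => /(congr1 -%R); rewrite opprB opprK.
Qed.

Lemma uniform_derive_close (I : finType) (u : I -> V) (g : V -> R) (x : V)
    (e : R) :
  (forall i, \forall y \near x, derivable g y (u i)) ->
  (forall i, {for x, continuous ('D_(u i) g)}) -> 0 < e ->
  exists2 d : R, 0 < d & forall y, `|x - y| < d -> forall i,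
    derivable g y (u i) /\ `|'D_(u i) g x - 'D_(u i) g y| <= e.
Proof.
move=> dg cg e0.
have : \forall y \near x, forall i,
    derivable g y (u i) /\ `|'D_(u i) g x - 'D_(u i) g y| <= e.
  apply: filter_forall => i; apply: filterI (dg i) _.
  by have /cvgrPdist_le/(_ _ e0) := cg i.
by move=> /nbhs_normP[d d0 dP]; exists d => // y xy; exact: dP.
Qed.

End mean_value.

Lemma continuous_mulmxr (R : realType) m n (L : 'M[R]_(m, n)) :
  continuous (mulmxr L : 'rV[R]_m -> 'rV[R]_n).
Proof.
move=> x; apply: (@Opow_continuous _ _ _ _ 0).
apply: (Opow_eq _ (Opow_mulmx (Opow_sub x) (Opow_cst x L))) => v.
by rewrite mulmxBl.
Qed.

Section partials.
Variables (R : realType) (n : nat).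
Local Notation e_ := (fun i : 'I_n => delta_mx 0 i : 'rV[R]_n).

(** Go from [x] to [h + x] changing one coordinate at a time. On each leg the mean value theorem
    gives a partial derivative at a nearby point, which continuity compares with the one at [x]. *)
Lemma differentiable_partials (g : 'rV[R]_n -> R) (x : 'rV[R]_n) :
  (forall i, \forall y \near x, derivable g y (e_ i)) ->
  (forall i, {for x, continuous ('D_(e_ i) g)}) -> differentiable g x.
Proof.
move=> dg cg.
pose df (h : 'rV[R]_n) := (h *m \col_i 'D_(e_ i) g x) 0 0.
have df_lin : linear df.
  by move=> a u v; rewrite /df mulmxDl -scalemxAl !mxE.
pose dfM := GRing.isLinear.Build _ _ _ _ df df_lin.
pose dfL : {linear 'rV[R]_n -> R} := HB.pack df dfM.
have dfE h : dfL h = \sum_i h 0 i * 'D_(e_ i) g x.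
  by rewrite /= /df mxE; apply: eq_bigr => i _; rewrite mxE.
have [||//] := @differentiable_eps _ _ _ g dfL x.
  move=> y; apply: (@continuous_comp _ _ _
    (mulmxr (\col_i 'D_(e_ i) g x) : 'rV[R]_n -> 'rV[R]_1)
    (fun M : 'rV[R]_1 => M 0 0)).
    exact: continuous_mulmxr.
  exact: coord_continuous.
(* Each of the [n] legs may cost [e' * |h|]; dividing by [n.+1] also covers [n = 0]. *)
move=> e e0; pose e' := e / (n.+1)%:R.
have e'0 : 0 < e' by rewrite divr_gt0.
have [d d0 dP] := uniform_derive_close dg cg e'0.
exists d => // h hd.
(* Corner [k] of the path: the first [k] coordinates have already been moved. *)
pose p k := x + \row_i (if (i < k)%N then h 0 i else 0).
(* Leg [i] stays in the ball where the partials are controlled, since no coordinate moves by more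
   than [|h|]. *)
have pE k s (i : 'I_n) : i = k :> nat -> `|s| <= `|h 0 i| ->
    `|x - (s *: e_ i + p k)| < d.
  move=> ik sh; apply: le_lt_trans hd; apply: mx_norm_le => // a j.
  rewrite !mxE ord1 eqxx/= -ik.
  have [->|ji] := eqVneq j i.
    rewrite ltnn mulr1 addr0 opprD addrCA subrr addr0 normrN.
    exact: le_trans sh (mx_entry_le _ _ _).
  rewrite mulr0 add0r opprD addrA subrr add0r normrN.
  by case: ifP; rewrite ?normr0// mx_entry_le.
have step (i : 'I_n) : exists2 c, `|c - 'D_(e_ i) g x| <= e' &
    g (p i.+1) - g (p i) = c * h 0 i.
  have [s sh|c ch E] := @MVT_increment R _ g (p i) (e_ i) (h 0 i).
    by have /(_ i)[] := dP _ (pE i s i erefl sh).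
  exists ('D_(e_ i) g (c *: e_ i + p i)).
    by rewrite distrC; have /(_ i)[] := dP _ (pE i c i erefl ch).
  rewrite -E; congr (g _ - _); rewrite /p addrCA; congr (_ + _).
  apply/rowP => j; rewrite !mxE eqxx/= ltnS leq_eqVlt.
  have [->|ji] := eqVneq j i; first by rewrite eqxx ltnn mulr1 addr0.
  by rewrite (negbTE (_ : j != i :> nat))//= mulr0 add0r.
have p0 : p 0 = x by apply/rowP => j; rewrite !mxE addr0.
have pn : p n = h + x.
  by apply/rowP => j; rewrite !mxE ltn_ord addrC.
(* Telescoping along the corners splits the error into one term per leg. *)
have -> : g (h + x) - g x - dfL h
    = \sum_(i < n) ((g (p i.+1) - g (p i)) - h 0 i * 'D_(e_ i) g x).
  rewrite sumrB -dfE.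
  have -> : \sum_(i < n) (g (p i.+1) - g (p i)) = g (p n) - g (p 0).
    by rewrite -(big_mkord xpredT (fun i => g (p i.+1) - g (p i))) telescope_sumr.
  by rewrite p0 pn.
rewrite (le_trans (ler_norm_sum _ _ _))//.
apply: (@le_trans _ _ (\sum_(i < n) (e' * `|h|))).
  apply: ler_sum => i _; have [c cD ->] := step i.
  by rewrite [_ * h 0 i]mulrC -mulrBr normrM mulrC ler_pM// mx_entry_le.
rewrite sumr_const card_ord -mulr_natr mulrAC ler_wpM2r//.
by rewrite /e' mulrAC ler_pdivrMr// ler_pM2l// ler_nat.
Qed.
End partials.

(** * Reading off value and derivative from a quadratic expansion *)

Section quad.
Variables (R : realType).

Lemma quadratic_expansion m n (f : 'rV[R]_m -> 'rV[R]_n) x c L :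
  Opow x 2 (fun v => f v - c - (v - x) *m L) ->
  [/\ f x = c, differentiable f x & jacobian f x = L].
Proof.
move=> /Opow_ball[C [d [C0 d0 fC]]].
have fx : f x = c.
  have := fC x; rewrite subrr mul0mx subr0 normr0 expr0n mulr0 => /(_ d0).
  by rewrite normr_le0 subr_eq0 => /eqP.
pose df : {linear 'rV[R]_m -> 'rV[R]_n} := mulmxr L.
have [||dfx E] := @differentiable_eps _ _ _ f df x.
- exact: continuous_mulmxr.
(* Below [e / C] the quadratic error [C * |h| ^ 2] is at most [e * |h|]. *)
- move=> e e0; exists (Num.min d (e / C)); first by rewrite lt_min d0 divr_gt0.
  move=> h; rewrite lt_min => /andP[hd he].
  have := fC (h + x); rewrite addrK fx => /(_ hd)/le_trans; apply.
  by rewrite expr2 mulrA ler_wpM2r// mulrC -ler_pdivlMr// ltW.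
split => //; apply/row_matrixP => i.
by rewrite !rowE /jacobian mul_rV_lin1 E.
Qed.

End quad.

(** * Inverse matrices and Euclidean norms *)

Section near.
Variables (R : realType) (V : normedModType R) (x : V).

Lemma near_norm_ball (P : V -> Prop) : (\forall y \near x, P y) ->
  exists2 d : R, 0 < d & forall y, `|y - x| < d -> P y.
Proof.
move=> /nbhs_normP[d d0 dP]; exists d => // y yx.
by apply: dP; rewrite /= distrC.
Qed.

(* [filterS] over an abstract normed module: on a matrix type, [nbhs] unfolds to
   the product filter and [filterS] itself does not apply. *)
Lemma near_imply (P Q : V -> Prop) : (forall y, P y -> Q y) ->
  (\forall y \near x, P y) -> \forall y \near x, Q y.
Proof. exact: filterS. Qed.

Lemma near_neq0 : x != 0 -> \forall y \near x, y != 0.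
Proof.
move=> x0; apply/nbhs_normP; exists `|x|; first by rewrite /= normr_gt0.
by move=> y /=; apply: contraTneq => ->; rewrite subr0 ltxx.
Qed.

Lemma near_eq_continuous (W : normedModType R) (f g : V -> W) :
  (\forall y \near x, f y = g y) -> {for x, continuous f} ->
  {for x, continuous g}.
Proof.
move=> fg cf; apply/cvgrPdist_le => e e0; near=> y.
have <- : f y = g y by near: y.
rewrite -(nbhs_singleton fg); near: y.
by move/cvgrPdist_le : cf; exact.
Unshelve. all: by end_near. Qed.

Lemma Opow_dom (W W' : normedModType R) k (M : R) (f : V -> W) (g : V -> W') :
  (\forall y \near x, `|f y| <= M * `|g y|) -> Opow x k g -> Opow x k f.
Proof.
move=> fg /OpowP[C C0 gC]; exists (`|M| * C); near=> y.
apply: (@le_trans _ _ (M * `|g y|)); first by near: y.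
apply: (@le_trans _ _ (`|M| * `|g y|)); first by rewrite ler_wpM2r ?ler_norm.
by rewrite -mulrA ler_wpM2l//; near: y.
Unshelve. all: by end_near. Qed.

(** For [v] near [x], [E v] is small and [invmx (B v) = N + invmx (B v) *m E v]; absorbing half the
    norm of the inverse on the left bounds it by [2 * |N|]. *)
Lemma Opow_invmx n (B : V -> 'M[R]_n) :
  B x \in unitmx -> Opow x 1 (fun v => B v - B x) ->
  (\forall v \near x, B v \in unitmx) /\ Opow x 0 (fun v => invmx (B v)).
Proof.
move=> Bu BO; pose N := invmx (B x); pose E v := 1%:M - B v *m N.
have EO : Opow x 1 E.
  apply: (Opow_eq _ (OpowN (Opow_mulmx BO (Opow_cst x N)))) => v.
  by rewrite mulmxBl mulmxV// opprB.
(* Chosen so that multiplication by [E v] at least halves norms despite the factor [n] of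
   [mulmx_norm_le]; [n.+1] avoids dividing by zero. *)
pose e : R := (2 * n.+1%:R)^-1.
have e0 : 0 < e by rewrite invr_gt0 mulr_gt0.
have half m (X : 'M[R]_(m, n)) v : `|E v| <= e -> `|X *m E v| <= `|X| / 2.
  move=> Ev; apply: le_trans (mulmx_norm_le _ _) _.
  rewrite mulrCA ler_wpM2l//; apply: (@le_trans _ _ (n%:R * e)).
    by rewrite ler_wpM2l.
  rewrite /e invfM mulrCA -[leRHS]mulr1 ler_wpM2l ?invr_ge0//.
  by rewrite ler_pdivrMr// mul1r ler_nat.
(* Neumann-type argument: a kernel vector u of B v satisfies u = u *m E v. *)
have unit_of v : `|E v| <= e -> B v \in unitmx.
  move=> Ev; rewrite -row_free_unit; apply: inj_row_free => u uB.
  have uE : u = u *m E v by rewrite mulmxBr mulmx1 mulmxA uB mul0mx subr0.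
  have := half _ u v Ev; rewrite -uE => u2; apply/normr0_eq0.
  by apply/eqP; rewrite eq_le normr_ge0 andbT; lra.
have nearE := Opow_cvg0 EO e0.
split; first by apply: filterS nearE.
exists (2 * `|N|); near=> v.
have Ev : `|E v| <= e by near: v.
rewrite expr0 mulr1.
have XE : invmx (B v) = N + invmx (B v) *m E v.
  by rewrite mulmxBr mulmx1 mulKmx ?unit_of// addrC subrK.
have := half _ (invmx (B v)) v Ev.
have := ler_normD N (invmx (B v) *m E v); rewrite -XE; lra.
Unshelve. all: by end_near. Qed.

End near.

(** * The Euclidean norm and the expansion of normalisation *)

Section norm2.
Variables (R : realType) (n : nat).
Implicit Types u v : 'rV[R]_n.

Lemma norm2_ge0 v : 0 <= norm2 v. Proof. exact: sqrtr_ge0. Qed.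

Lemma sqr_norm2 v : norm2 v ^+ 2 = (v *m v^T) 0 0.
Proof.
rewrite sqr_sqrtr; last by apply: sumr_ge0 => i _; exact: sqr_ge0.
by rewrite mxE; apply: eq_bigr => i _; rewrite mxE expr2.
Qed.

Lemma norm2Z (a : R) v : norm2 (a *: v) = `|a| * norm2 v.
Proof.
apply/eqP; rewrite -(@eqrXn2 _ 2)// ?mulr_ge0 ?norm2_ge0//.
rewrite exprMn !sqr_norm2 real_normK ?num_real// linearZ/=.
by rewrite -scalemxAl -scalemxAr scalerA !mxE expr2.
Qed.

(** With [norm2_le_norm], this transfers estimates proved in the maximum norm to the Euclidean
    norm. *)
Lemma norm_le_norm2 v : `|v| <= norm2 v.
Proof.
apply: mx_norm_le => [|i j]; first exact: norm2_ge0.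
rewrite ord1 -sqrtr_sqr ler_wsqrtr// (bigD1 j)//= lerDl.
by apply: sumr_ge0 => k _; exact: sqr_ge0.
Qed.

Lemma norm2_le_norm v : norm2 v <= Num.sqrt n%:R * `|v|.
Proof.
rewrite -[`|v|]ger0_norm// -sqrtr_sqr -sqrtrM// ler_wsqrtr//.
rewrite mulr_natl -[X in _ *+ X]card_ord -sumr_const; apply: ler_sum => i _.
by rewrite -real_normK ?num_real// lerXn2r ?nnegrE// mx_entry_le.
Qed.

(** First-order expansion of [s ^ (-1/2)] at [s = a ^ 2], evaluated at [s = b ^ 2]. The remainder is
    exactly [c] times the squared increment, and [c] is bounded because [b] stays away from 0. *)
Lemma inv_expansion (a b : R) : 0 < a -> 0 <= b ->
  `|b ^+ 2 - a ^+ 2| <= 3 / 4 * a ^+ 2 ->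
  `|b^-1 - a^-1 + (2 * a ^+ 3)^-1 * (b ^+ 2 - a ^+ 2)|
     <= (2 / a ^+ 5) * `|(b ^+ 2 - a ^+ 2) ^+ 2|.
Proof.
move=> a0 b0 ab.
(* The hypothesis gives [b ^ 2 >= a ^ 2 / 4]. *)
have ba : a / 2 <= b.
  have := ab; rewrite ler_norml => /andP[ab1 _].
  rewrite -(@ler_pXn2r _ 2) ?nnegrE//; last by rewrite divr_ge0 ?ltW.
  rewrite expr_div_n; lra.
have bp : 0 < b by apply: lt_le_trans ba; rewrite divr_gt0.
pose c := (a / (a + b) + 1) / (2 * a ^+ 3 * b * (a + b)).
have -> : b^-1 - a^-1 + (2 * a ^+ 3)^-1 * (b ^+ 2 - a ^+ 2)
    = c * (b ^+ 2 - a ^+ 2) ^+ 2.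
  by rewrite /c; field; rewrite !gt_eqF// addr_gt0.
rewrite normrM ler_wpM2r// ger0_norm; last first.
  by rewrite /c divr_ge0 ?addr_ge0 ?divr_ge0 ?mulr_ge0 ?exprn_ge0 ?addr_ge0 ?ltW.
(* Split to match [c] factor by factor: its numerator is at most 2, while [b >= a / 2] and
   [a + b >= a]. *)
have -> : 2 / a ^+ 5 = 2 / (2 * a ^+ 3 * (a / 2) * a).
  by field; rewrite gt_eqF.
rewrite /c; apply: ler_pM.
- by rewrite addr_ge0// divr_ge0 ?addr_ge0// ltW.
- by rewrite invr_ge0 !mulr_ge0 ?exprn_ge0 ?addr_ge0 ?ltW.
- have : a / (a + b) <= 1 by rewrite ler_pdivrMr ?addr_gt0// mul1r lerDl ltW.
  by lra.
rewrite lef_pV2 ?posrE ?mulr_gt0 ?exprn_gt0 ?addr_gt0 ?divr_gt0//.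
apply: ler_pM; rewrite ?mulr_ge0 ?exprn_ge0 ?divr_ge0 ?(ltW a0)//.
  by rewrite ler_wpM2l// ?mulr_ge0 ?exprn_ge0 ?(ltW a0).
by rewrite lerDl ltW.
Qed.

End norm2.

Lemma mx_subE (R : zmodType) m n (M N : 'M[R]_(m, n)) i j :
  (M - N) i j = M i j - N i j.
Proof. by rewrite !mxE. Qed.

(** [D] is the first-order part of [f - w], and the last bracket is the derivative of normalisation
    at [w] applied to it. Expanding the inverse norm in the squared norm avoids differentiating a
    square root. *)
Lemma Opow_normalize (R : realType) (V : normedModType R) (x : V) n
    (f D : V -> 'rV[R]_n) (w : 'rV[R]_n) :
  0 < norm2 w -> Opow x 1 D -> Opow x 2 (fun v => f v - w - D v) ->
  Opow x 2 (fun v => (norm2 (f v))^-1 *: f v - (norm2 w)^-1 *: w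
    - ((norm2 w)^-1 *: D v
       - ((norm2 w)^-1 ^+ 3 * (D v *m w^T) 0 0) *: w)).
Proof.
set a := norm2 w => a0 DO fO.
pose e v := f v - w.
have eO : Opow x 1 e.
  by apply: Opow_eq (OpowD (@Opow_le _ _ _ _ 1 2 _ isT fO) DO) => v; rewrite subrK.
pose q v := norm2 (f v) ^+ 2 - a ^+ 2.
have qE v : q v = 2 * (e v *m w^T) 0 0 + (e v *m (e v)^T) 0 0.
  rewrite /q /a !sqr_norm2 -[f v](subrK w) -/(e v) linearD/= mulmxDl !mulmxDr !mxE.
  rewrite (_ : \sum_j w 0 j * (e v)^T j 0 = \sum_j e v 0 j * w^T j 0).
    by ring.
  by apply: eq_bigr => j _; rewrite !mxE mulrC.
have eeO : Opow x 2 (fun v => (e v *m (e v)^T) 0 0).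
  exact: Opow_entry (Opow_mulmx eO (Opow_tr eO)).
have ewO : Opow x 1 (fun v => (e v *m w^T) 0 0).
  exact: Opow_entry (Opow_mulmx eO (Opow_cst _ _)).
have qO : Opow x 1 q.
  have ew2O : Opow x 1 (fun v => 2 * (e v *m w^T) 0 0) := OpowcM 2 ewO.
  apply: Opow_eq (OpowD ew2O (@Opow_le _ _ _ _ 1 2 _ isT eeO)) => v.
  by rewrite qE.
have q2O : Opow x 2 (fun v => q v - 2 * (D v *m w^T) 0 0).
  have dwO : Opow x 2 (fun v => ((e v - D v) *m w^T) 0 0).
    exact: Opow_entry (Opow_mulmx fO (Opow_cst _ _)).
  have dw2O : Opow x 2 (fun v => 2 * ((e v - D v) *m w^T) 0 0) := OpowcM 2 dwO.
  apply: Opow_eq (OpowD dw2O eeO) => v.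
  by rewrite qE mulmxBl mx_subE; ring.
pose r v := (norm2 (f v))^-1 - a^-1 + (2 * a ^+ 3)^-1 * q v.
have rO : Opow x 2 r.
  apply: (@Opow_dom _ _ _ _ _ _ (2 / a ^+ 5) _ (fun v => q v ^+ 2)); last first.
    exact: (OpowM qO qO).
  have /(Opow_cvg0 qO) : 0 < 3 / 4 * a ^+ 2 by rewrite mulr_gt0// exprn_gt0.
  by apply: filterS => v; apply: inv_expansion => //; exact: norm2_ge0.
have r0O : Opow x 2 (fun v => r v *: f v).
  rewrite -[2%N]addn0; apply: OpowZ rO _.
  exact: Opow_cst_diff eO.
have qeO : Opow x 2 (fun v => ((2 * a ^+ 3)^-1 * q v) *: e v).
  exact: (OpowZ (OpowcM _ qO) eO).
have qwO : Opow x 2 (fun v => ((2 * a ^+ 3)^-1 * (q v - 2 * (D v *m w^T) 0 0)) *: w).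
  exact: (OpowZc _ (OpowcM _ q2O)).
(* Substituting [r] and [f v = w + e v] writes the remainder as [r f - q e / (2 a^3) + (e - D) / a -
   (q - 2 D w^T) w / (2 a^3)], each term quadratic. *)
have aO : Opow x 2 (fun v => a^-1 *: (e v - D v)).
  exact: (OpowcZ _ fO).
apply: Opow_eq (OpowD (OpowB r0O qeO) (OpowB aO qwO)) => v.
set t := (D v *m w^T) 0 0.
have an0 : a != 0 by rewrite gt_eqF.
set b := (norm2 (f v))^-1.
apply/rowP => j; rewrite /r /e !mxE -/b.
by field.
Qed.

(** * The map v |-> A(v) v and its Jacobian *)

(** Near [x] the derivative of an entry is the entry of the derivative, so existence and continuity
    pass from the matrix to its entries. *)
Lemma Ck_on_entry (R : realType) (V : normedModType R) (m n k : nat)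
    (U : set V) (f : V -> 'M[R]_(m, n)) us u x i j :
  Ck_on k U f -> (size us < k)%N -> (\forall y \near x, U y) ->
  (\forall y \near x, derivable (fun z => iter_derive us f z i j) y u) /\
  {for x, continuous ('D_u (fun z => iter_derive us f z i j))}.
Proof.
move=> fC usk Ux; have Uxx := nbhs_singleton Ux.
have [_ /(_ usk) dus] := fC us (ltnW usk).
have [cu _] := fC (u :: us) usk.
split.
  apply: filterS Ux => y Uy.
  by have /derivable_mxP := dus u y Uy; exact.
apply: (@near_eq_continuous _ _ _ _ (fun y => iter_derive (u :: us) f y i j)).
  apply: filterS Ux => y Uy /=.
  by rewrite derive_mx ?mxE//; exact: dus.
apply: (@continuous_comp _ _ _ (iter_derive (u :: us) f) (fun M => M i j)).
  exact: cu.
exact: coord_continuous.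
Qed.

Lemma Ck_on_differentiable (R : realType) (m n p k : nat)
    (f : 'rV[R]_p -> 'M[R]_(m, n)) us x i j :
  Ck_on k [set v | v != 0] f -> (size us < k)%N -> x != 0 ->
  differentiable (fun y => iter_derive us f y i j) x.
Proof.
move=> fC usk x0; apply: differentiable_partials => l.
  by have [] := Ck_on_entry (delta_mx 0 l) i j fC usk (near_neq0 x0).
by have [] := Ck_on_entry (delta_mx 0 l) i j fC usk (near_neq0 x0).
Qed.

Lemma differentiable_row (R : realType) (V : normedModType R) n
    (f : V -> 'rV[R]_n) x :
  (forall j, differentiable (fun v => f v 0 j) x) -> differentiable f x.
Proof.
move=> df.
rewrite (_ : f = \sum_j (fun v => f v 0 j *: delta_mx 0 j : 'rV[R]_n)).
  by apply: differentiable_sum => j; exact: differentiableZl.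
by apply/funext => v; rewrite fct_sumE -row_sum_delta.
Qed.

Lemma ball_Opow (R : realType) (V W : normedModType R) (x : V) k (C d : R)
    (f : V -> W) : 0 < d ->
  (forall v, `|v - x| < d -> `|f v| <= C * `|v - x| ^+ k) -> Opow x k f.
Proof.
move=> d0 fC; exists C; apply/nbhs_normP; exists d => // v.
by rewrite /= distrC; exact: fC.
Qed.

Lemma derive_row_entry (R : realType) m n (f : 'rV[R]_m -> 'rV[R]_n) y h j :
  differentiable f y ->
  derivable (fun v => f v 0 j) y h /\
  'D_h (fun v => f v 0 j) y = (h *m jacobian f y) 0 j.
Proof.
move=> df; have dfh : derivable f y h by exact: diff_derivable.
split; first by have /derivable_mxP := dfh; exact.
by rewrite -deriveEjacobian// derive_mx// mxE.
Qed.

(** Mean value theorem along the segment, one coordinate at a time: the intermediate point depends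
    on [j], but its Jacobian is always within [C * |h|] of that at [x]. *)
Lemma Opow_taylor (R : realType) m n (f : 'rV[R]_m -> 'rV[R]_n) x :
  (\forall y \near x, differentiable f y) ->
  Opow x 1 (fun v => jacobian f v - jacobian f x) ->
  Opow x 2 (fun v => f v - f x - (v - x) *m jacobian f x).
Proof.
move=> /near_norm_ball[d d0 df] /Opow_ball[C [d' [C0 d'0 JC]]].
apply: (@ball_Opow _ _ _ _ _ (m%:R * C) (Num.min d d')); first by rewrite lt_min d0.
move=> v; rewrite lt_min => /andP[vd vd'].
set h := v - x in vd vd' *.
have le_h s : 0 <= s <= 1 -> `|s *: h + x - x| <= `|h|.
  by move=> /andP[s0 s1]; rewrite addrK normrZ ger0_norm// ler_piMl.
apply: mx_norm_le => [|i j]; first by rewrite !mulr_ge0 ?exprn_ge0// ltW.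
have [|s s01 E] := @MVT_line R _ (fun y => f y 0 j) x h 0 1 ler01.
  move=> s s01.
  by have [] := derive_row_entry h j (df _ (le_lt_trans (le_h s s01) vd)).
have [_ DE] := derive_row_entry h j (df _ (le_lt_trans (le_h s s01) vd)).
have -> : (f v - f x - h *m jacobian f x) i j
    = (h *m (jacobian f (s *: h + x) - jacobian f x)) 0 j.
  move: E; rewrite scale1r scale0r add0r subrK subr0 mulr1 DE => E.
  by rewrite ord1 mulmxBr !mx_subE E.
apply: le_trans (mx_entry_le _ _ _) _; apply: le_trans (mulmx_norm_le _ _) _.
rewrite -mulrA ler_wpM2l// mulrC expr2 mulrA ler_wpM2r//.
apply: le_trans (JC _ (le_lt_trans (le_h s s01) vd')) _.
by rewrite expr1 ler_wpM2l ?(ltW C0) ?le_h.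
Qed.

(** Euler's identity. For [0 < |h| < 1] the scalar [h + 1] is nonzero, so homogeneity makes the
    difference quotient equal to [f v] exactly. *)
Lemma derive_homogeneous (R : realType) (V W : normedModType R) (f : V -> W)
    (v : V) : (forall a : R, a != 0 -> f (a *: v) = a *: f v) -> 'D_v f v = f v.
Proof.
move=> fZ; apply/cvg_lim => //.
apply: (@cvg_trans _ ((fun=> f v) @ (0 : R)^')); last exact: cvg_cst.
apply: near_eq_cvg.
have nz : \forall h \near (0 : R)^', h != 0 by exact: nbhs_dnbhs_neq.
have lt1 : \forall h \near (0 : R)^', `|h| < 1 by exact: (dnbhs0_lt ltr01).
apply: filterS2 nz lt1 => h h0; rewrite ltr_norml => /andP[h1 _] /=.
have h10 : h + 1 != 0 by rewrite gt_eqF// -ltrBlDr sub0r.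
rewrite -[X in f (_ + X)](scale1r v) -scalerDl fZ// scalerDl scale1r addrK.
by rewrite scalerA mulVf// scale1r.
Qed.

Section Fmap.
Variables (R : realType) (n : nat) (A : 'rV[R]_n -> 'M[R]_n).
Hypothesis A_C3 : Ck_on 3 [set v | v != 0] A.

(** The product rule for the [j]-th coordinate of [A(v) v] in direction [u], in explicit form so
    that it can be differentiated again. *)
Let dF (u : 'rV[R]_n) (j : 'I_n) (v : 'rV[R]_n) : R :=
  \sum_(k < n) (v 0 k * ('D_u A v) j k + A v j k * u 0 k).

Lemma Fmap_entryE j :
  (fun v => Fmap A v 0 j : R) =
  \sum_(k < n) ((fun v : 'rV[R]_n => v 0 k : R) * (fun v => A v j k : R)).
Proof.
apply/funext => v; rewrite fct_sumE mxE; apply: eq_bigr => k _.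
by rewrite mxE.
Qed.

Lemma derive_coord (u v : 'rV[R]_n) k : 'D_u (fun y : 'rV[R]_n => y 0 k) v = u 0 k.
Proof.
have := derive_id v u; rewrite derive_mx//= => /rowP/(_ k).
by rewrite mxE.
Qed.

Lemma differentiable_A j k v : v != 0 -> differentiable (fun y => A y j k) v.
Proof. by move=> v0; exact: (@Ck_on_differentiable _ _ _ _ _ _ [::] _ _ _ A_C3). Qed.

Lemma differentiable_Fmap v : v != 0 -> differentiable (Fmap A) v.
Proof.
move=> v0; apply: differentiable_row => j; rewrite Fmap_entryE.
apply: differentiable_sum => k; apply: differentiableM.
  exact: differentiable_coord.
exact: differentiable_A.
Qed.

Lemma derive_Fmap_entry u j v : v != 0 -> 'D_u (fun y => Fmap A y 0 j) v = dF u j v.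
Proof.
move=> v0; have dA : derivable A v u.
  by have [_ /(_ isT)] := A_C3 (isT : (size [::] <= 3)%N); exact.
have dAe k : derivable (fun y => A y j k : R) v u.
  exact: diff_derivable (differentiable_A j k v0).
have dc k : derivable (fun y : 'rV[R]_n => y 0 k) v u.
  exact/diff_derivable/differentiable_coord.
rewrite Fmap_entryE derive_sum => [|k]; last exact: derivableM.
by apply: eq_bigr => k _; rewrite deriveM// derive_coord derive_mx// mxE.
Qed.

Lemma differentiable_dF u j v : v != 0 -> differentiable (dF u j) v.
Proof.
move=> v0; rewrite (_ : dF u j = \sum_(k < n) ((fun v : 'rV[R]_n => v 0 k : R) *
    (fun v => ('D_u A v) j k : R) + (fun v => A v j k : R) * cst (u 0 k))); last first.
  by apply/funext => y; rewrite fct_sumE.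
apply: differentiable_sum => k; apply: differentiableD; apply: differentiableM => //.
- exact: differentiable_coord.
- exact: (@Ck_on_differentiable _ _ _ _ _ _ [:: u] _ _ _ A_C3).
- exact: differentiable_A.
Qed.

(** Away from 0 each entry of the Jacobian is some [dF], which is differentiable at [x] and hence
    Lipschitz there. *)
Lemma jacobian_Fmap_lipschitz x : x != 0 ->
  Opow x 1 (fun v => jacobian (Fmap A) v - jacobian (Fmap A) x).
Proof.
move=> x0; apply: Opow_mx => i j.
have jacE y : y != 0 -> jacobian (Fmap A) y i j = dF (delta_mx 0 i) j y.
  move=> y0; rewrite -derive_Fmap_entry//.
  have [_ ->] := derive_row_entry (delta_mx 0 i) j (differentiable_Fmap y0).
  by rewrite -rowE [RHS]mxE.
apply: Opow_near (differentiable_Opow (differentiable_dF (delta_mx 0 i) j x0)).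
apply: near_imply (near_neq0 x0) => y y0.
apply: esym; apply: etrans (mx_subE _ _ _ _) _.
by congr (_ - _); exact: jacE.
Qed.

End Fmap.

Lemma FmapZ (R : realType) n (A : 'rV[R]_n -> 'M[R]_n) :
  (forall (a : R) v, a != 0 -> A (a *: v) = A v) ->
  forall v (a : R), a != 0 -> Fmap A (a *: v) = a *: Fmap A v.
Proof. by move=> AZ v a a0; rewrite /Fmap /mv AZ// -scalemxAl. Qed.

(** * Expansion of the Newton map *)

(** For [G], [H] the Jacobians at [v], [u], Euler's identity turns the left side into the Taylor
    remainder of [Fmap] less a product of two first-order terms. *)
Lemma taylor_remainder_mul (R : realType) n (u v : 'rV[R]_n) (G H : 'M[R]_n) :
  v *m G - u *m H - (v - u) *m H - (v - u) *m (G - H) = u *m (G - H).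
Proof.
rewrite !mulmxBl !mulmxBr.
move: (v *m G) (v *m H) (u *m G) (u *m H) => a b c d.
by apply/rowP => j; rewrite !mxE; ring.
Qed.

(** Multiply by [B] on the right, write [B = B0 + (B - B0)] and use [u *m B0 = mu *: u]: only the
    terms with [B - B0] survive. *)
Lemma resolvent_remainder (R : realType) n (u v : 'rV[R]_n) (B0 B : 'M[R]_n)
    (mu : R) :
  B0 \in unitmx -> B \in unitmx -> mu != 0 -> u *m B0 = mu *: u ->
  v *m invmx B - mu^-1 *: u - (v - u) *m invmx B0 =
  - ((v - u) *m invmx B0 *m (B - B0) + mu^-1 *: (u *m (B - B0))) *m invmx B.
Proof.
move=> B0u Bu mu0 uB0; apply: (canRL (mulmxK Bu)).
rewrite 2!mulmxBl (mulmxKV Bu) !mulmxBr uB0 (mulmxKV B0u) scalerBr scalerA.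
rewrite mulVf// scale1r -scalemxAl.
move: (_ *m invmx B0 *m B) (_ *: (_ *m B)) => a b.
by apply/rowP => j; rewrite !mxE; ring.
Qed.

(** Identifies the derivative of normalisation at [w = mu^-1 *: u], where [|w| = 1 / |mu|] for a
    unit vector [u], with a projection; the scalars agree as [|mu| ^ 3 / mu ^ 2 = |mu|]. *)
Lemma normalized_projector (R : realType) n (h u : 'rV[R]_n) (N : 'M[R]_n)
    (mu : R) : mu != 0 ->
  h *m (`|mu| *: (N *m (1%:M - u^T *m u))) =
  `|mu| *: (h *m N)
    - (`|mu| ^+ 3 * (h *m N *m (mu^-1 *: u)^T) 0 0) *: (mu^-1 *: u).
Proof.
move=> mu0; rewrite -scalemxAr mulmxA; set d := h *m N.
rewrite mulmxBr mulmx1 scalerBr; congr (_ - _).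
have -> : (mu^-1 *: u)^T = mu^-1 *: u^T by rewrite linearZ.
rewrite mulmxA [d *m u^T]mx11_scalar mul_scalar_mx -scalemxAr.
rewrite [(_ *: (d *m _)) 0 0]mxE !scalerA; congr (_ *: _).
by rewrite exprSr real_normK ?num_real//; field.
Qed.

(** The value at [vstar] is [vstar] times the sign of [mu]. In the row convention the linear part is
    the transpose of the claimed Jacobian matrix. *)
Lemma phi_expansion (R : realType) n (A : 'rV[R]_n -> 'M[R]_n)
    (lambda sigma : R) (vstar : 'rV[R]_n) :
  let mu := lambda - sigma in
  let N := invmx (jacobian (Fmap A) vstar - sigma%:M) in
  Ck_on 3 [set v | v != 0] A ->
  (forall (alpha : R) v, alpha != 0 -> A (alpha *: v) = A v) ->
  mv (A vstar) vstar = lambda *: vstar ->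
  norm2 vstar = 1 ->
  jacobian (Fmap A) vstar - sigma%:M \in unitmx ->
  mu != 0 /\
  Opow vstar 2 (fun v => phi A sigma v - (`|mu| / mu) *: vstar
    - (v - vstar) *m (`|mu| *: (N *m (1%:M - vstar^T *m vstar)))).
Proof.
move=> mu N A_C3 AZ eig v1 Bu.
have vs0 : vstar != 0.
  apply/eqP => vs0; move: v1; rewrite vs0 -(scale0r 0) norm2Z normr0 mul0r.
  by move/esym/eqP; rewrite oner_eq0.
pose B v := jacobian (Fmap A) v - sigma%:M.
have euler v : v != 0 -> v *m jacobian (Fmap A) v = Fmap A v.
  move=> v0; rewrite -deriveEjacobian; last exact: differentiable_Fmap.
  by apply: derive_homogeneous; exact: FmapZ.
have vB : vstar *m B vstar = mu *: vstar.
  by rewrite mulmxBr euler// mul_mx_scalar scalerBl -eig.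
(* Otherwise the nonzero [vstar] would lie in the left kernel of the invertible [B vstar]. *)
have mu0 : mu != 0.
  apply: contra_neq vs0 => mu0; move: vB; rewrite mu0 scale0r => vB.
  by rewrite -[vstar](mulmxK Bu) vB mul0mx.
split=> //.
have BB v : B v - B vstar = jacobian (Fmap A) v - jacobian (Fmap A) vstar.
  by rewrite /B opprB addrA subrK.
have BO : Opow vstar 1 (fun v => B v - B vstar).
  by apply: Opow_eq (jacobian_Fmap_lipschitz A_C3 vs0) => v; rewrite BB.
have [Bunit invO] := @Opow_invmx _ _ vstar _ B Bu BO.
have near0 := near_neq0 vs0.
have dF : \forall y \near vstar, differentiable (Fmap A) y.
  by apply: near_imply near0 => y; exact: differentiable_Fmap.
have taylor := Opow_taylor dF (jacobian_Fmap_lipschitz A_C3 vs0).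
have hO := Opow_sub vstar.
(* The decisive gain of one order: [B v - B vstar] is only first order, but Euler's identity makes
   its product with [vstar] second order. *)
have vBO : Opow vstar 2 (fun v => vstar *m (B v - B vstar)).
  apply: Opow_near (OpowB taylor (Opow_mulmx hO BO)).
  apply: near_imply near0 => v v0.
  by rewrite BB -(euler v v0) -(euler vstar vs0); exact: taylor_remainder_mul.
pose w := mu^-1 *: vstar.
have psiO : Opow vstar 2 (fun v => psi A sigma v - w - (v - vstar) *m N).
  have rO : Opow vstar 2 (fun v => - (((v - vstar) *m N) *m (B v - B vstar)
      + mu^-1 *: (vstar *m (B v - B vstar))) *m invmx (B v)).
    have hN : Opow vstar 1 (fun v => (v - vstar) *m N).
      exact: (Opow_mulmx hO (Opow_cst _ N)).
    have hNB : Opow vstar 2 (fun v => (v - vstar) *m N *m (B v - B vstar)).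
      exact: (Opow_mulmx hN BO).
    exact: (Opow_mulmx (OpowN (OpowD hNB (OpowcZ mu^-1 vBO))) invO).
  apply: Opow_near rO; apply: near_imply Bunit => v Bv.
  (* The transpose in [mv] cancels the one in [Jac]. *)
  have -> : psi A sigma v = v *m invmx (B v).
    by rewrite /psi /mv /Jmap /Jac trmx_inv linearB/= trmxK tr_scalar_mx.
  by rewrite (resolvent_remainder v Bu Bv mu0 vB).
have norm2w : norm2 w = `|mu|^-1 by rewrite norm2Z v1 mulr1 normfV.
have := @Opow_normalize _ _ vstar _ (psi A sigma) (fun v => (v - vstar) *m N) w.
rewrite norm2w invr_gt0 normr_gt0 invrK => /(_ mu0 _ psiO).
move=> /(_ (Opow_mulmx hO (Opow_cst _ N))).
apply: Opow_eq => v.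
by rewrite /phi scalerA -normalized_projector.
Qed.

(** * The derivative of the Newton map and the local error estimate *)

Theorem theorem3 (R : realType) (n : nat) (A : 'rV[R]_n -> 'M[R]_n)
  (lambda sigma : R) (vstar : 'rV[R]_n) :
  (forall v, (A v)^T = A v) ->
  Ck_on 3 [set v | v != 0] A ->
  (forall (alpha : R) v, alpha != 0 -> A (alpha *: v) = A v) ->
  mv (A vstar) vstar = lambda *: vstar ->
  norm2 vstar = 1 ->
  Jmap A vstar - sigma%:M \in unitmx ->
  (differentiable (phi A sigma) vstar /\
   Jac (phi A sigma) vstar
     = `|lambda - sigma| *: ((1%:M - vstar^T *m vstar)
                             *m invmx (Jmap A vstar - sigma%:M))) /\
  (forall vs : nat -> 'rV[R]_n,
     (forall k, vs k.+1 = phi A sigma (vs k)) ->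
     (forall k, Jmap A (vs k) - sigma%:M \in unitmx) ->
     exists C delta : R, 0 < delta /\
       forall k, norm2 (vs k - vstar) < delta ->
         (sigma < lambda ->
            norm2 (vs k.+1 - vstar
                   - mv (Jac (phi A sigma) vstar) (vs k - vstar))
              <= C * norm2 (vs k - vstar) ^+ 2) /\
         (lambda < sigma ->
            norm2 (vs k.+1 + vstar
                   - mv (Jac (phi A sigma) vstar) (vs k - vstar))
              <= C * norm2 (vs k - vstar) ^+ 2)).
Proof.
move=> _ A_C3 AZ eig v1 Ju.
set G := jacobian (Fmap A) vstar.
have JE : Jmap A vstar - sigma%:M = (G - sigma%:M)^T.
  by rewrite linearB/= tr_scalar_mx.
have Bu : G - sigma%:M \in unitmx by rewrite -unitmx_tr -JE.
have [mu0 phiO] := phi_expansion A_C3 AZ eig v1 Bu.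
set mu := lambda - sigma in mu0 phiO *.
have [phiv dphi Jphi] := quadratic_expansion phiO.
split.
  split=> //; rewrite /Jac Jphi JE -trmx_inv linearZ/= trmx_mul.
  by rewrite linearB/= trmx1 trmx_mul trmxK.
move=> vs vsS _.
have [C [d [C0 d0 phiC]]] := Opow_ball phiO.
(* The factor [sqrt n] pays for the Euclidean norm of the error; the radius [d] carries over because
   the maximum norm is below the Euclidean one. *)
exists (Num.sqrt n%:R * C), d; split=> // k vk.
(* Both sign cases at once: [c] is 1 if [sigma < lambda] and -1 if [lambda < sigma]. *)
have bound c : `|mu| / mu = c ->
    norm2 (vs k.+1 - c *: vstar - mv (Jac (phi A sigma) vstar) (vs k - vstar))
      <= Num.sqrt n%:R * C * norm2 (vs k - vstar) ^+ 2.
  move=> <-; rewrite /mv /Jac trmxK Jphi vsS.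
  apply: le_trans (norm2_le_norm _) _.
  rewrite -mulrA ler_wpM2l ?sqrtr_ge0//.
  apply: le_trans (phiC _ (le_lt_trans (norm_le_norm2 _) vk)) _.
  by rewrite ler_pM2l// lerXn2r ?nnegrE ?norm2_ge0 ?norm_le_norm2.
split=> ls.
  by have := bound 1; rewrite scale1r; apply; rewrite gtr0_norm ?subr_gt0// divff.
have := bound (- 1); rewrite scaleN1r opprK; apply.
by rewrite ltr0_norm ?subr_lt0// mulNr divff.
Qed.
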